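(* Let $n\geq 8$ be an integer. For every integer $i$ with $4\leq i\leq n+1$, there exists a finite simple non-complete connected graph $G$ on the vertex set $[n]=\{1,\ldots,n\}$ such that $\kappa(G)=1$ and $\phi(G)=i$, where $\phi(G)=f(G)+\operatorname{diam}(G)+\kappa(G)$.
   Context: For a finite simple connected graph $G$ on $[n]$: the distance of two distinct vertices is the smallest length (number of edges) of a path in $G$ connecting them, and $\operatorname{diam}(G)$ is the maximum of all such distances. $\kappa(G)$ denotes the vertex connectivity: for non-complete $G$, the smallest cardinality of a subset $T\subset[n]$ such that the induced subgraph of $G$ on $[n]\setminus T$ is disconnected. A vertex $i$ is free (simplicial) if whenever $\{i,j\},\{i,j'\}\in E(G)$ with $j\neq j'$, then $\{j,j'\}\in E(G)$. $f(G)$ denotes the number of free vertices of $G$. *)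

(* Defs.v *)
From mathcomp Require Import all_boot.

Set Implicit Arguments.
Unset Strict Implicit.
Unset Printing Implicit Defensive.

Record sgraph (T : finType) := SGraph {
  adj :> rel T;
  adj_sym : symmetric adj;
  adj_irr : irreflexive adj
}.

Section Graph.
Variable T : finType.
Implicit Type G : sgraph T.

Definition complete G : bool := [forall x, forall y, (x != y) ==> G x y].

Definition connected G : bool := [forall x, forall y, connect G x y].

Definition is_path G (x y : T) (p : seq T) : bool :=
  [&& path G x p, last x p == y & uniq (x :: p)].

(* A path has at most #|T| vertices, hence length < #|T|; the default value
   #|T| is reached only when no path joins x to y. *)
Definition dist G (x y : T) : nat :=
  \big[minn/#|T|]_(k < #|T| | [exists p : k.-tuple T, is_path G x y p]) k.

Definition diam G : nat := \max_(x : T) \max_(y : T | x != y) dist G x y.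

Definition free G (x : T) : bool :=
  [forall y, forall z, [&& G x y, G x z & y != z] ==> G y z].

Definition nfree G : nat := #|[set x | free G x]|.

Definition induced_adj G (A : {set T}) : rel {x : T | x \in A} :=
  relpre val G.

Lemma induced_sym G A : symmetric (@induced_adj G A).
Proof. by move=> x y; apply: adj_sym. Qed.

Lemma induced_irr G A : irreflexive (@induced_adj G A).
Proof. by move=> x; apply: adj_irr. Qed.

Definition induced G (A : {set T}) : sgraph {x : T | x \in A} :=
  SGraph (@induced_sym G A) (@induced_irr G A).

End Graph.

(* If G is not complete, disconnecting sets exist and all have at most
   #|T| - 2 elements, so the default value #|T|.-1 plays no role; it is the
   usual convention for complete graphs. *)
Definition kappa (T : finType) (G : sgraph T) : nat :=
  \big[minn/#|T|.-1]_(S : {set T} | ~~ connected (induced G (~: S))) #|S|.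

Definition phi (T : finType) (G : sgraph T) : nat := nfree G + diam G + kappa G.

(* Main.v *)
Require Import Defs.
From mathcomp Require Import all_boot.
From mathcomp Require Import zify.

(** Let [G] be a cone over a disconnected graph [H] having an isolated vertex.
    Then [diam G = 2], [kappa G = 1], the apex is not free, and the other free
    vertices of [G] are those of [H].  So it suffices to find, for each
    [1 <= j <= n - 2], such an [H] on [n - 1] vertices with exactly [j] non-free
    vertices: take isolated vertices together with a path on [j + 2] vertices
    if [j <= 3], and with the complete bipartite graph K_{2,j-2} if [j >= 4]. *)

Lemma bigminn_geq (I : Type) (r : seq I) (P : pred I) (F : I -> nat) (d m : nat) :
  m <= d -> (forall i, P i -> m <= F i) -> m <= \big[minn/d]_(i <- r | P i) F i.
Proof.
by move=> le_md le_mF; elim/big_rec: _ => // i k Pi le_mk; rewrite leq_min le_mF.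
Qed.

Lemma bigminn_leq (I : finType) (P : pred I) (F : I -> nat) (d : nat) (i : I) :
  P i -> \big[minn/d]_(k | P k) F k <= F i.
Proof.
move=> Pi; have := mem_index_enum i; elim: (index_enum I) => // k r IHr.
rewrite inE big_cons => /predU1P[<-|/IHr le_r]; first by rewrite Pi geq_minl.
by case: ifP => // _; rewrite geq_min le_r orbT.
Qed.

(** The vertices of a path are distinct, so its length is below [#|T|] and is an index of the
    minimum defining [dist]. *)
Lemma dist_leq (T : finType) (G : sgraph T) (x y : T) (p : seq T) :
  is_path G x y p -> dist G x y <= size p.
Proof.
move=> Gp; have /and3P[_ _ Up] := Gp.
have lt_p : size p < #|T| by have := max_card (mem (x :: p)); rewrite (card_uniqP Up).
apply: (@bigminn_leq _ _ (fun k : 'I_#|T| => k : nat) _ (Ordinal lt_p)).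
by apply/existsP; exists (in_tuple p).
Qed.

Lemma apex_connected (T : finType) (G : sgraph T) (c : T) :
  (forall x, x != c -> G c x) -> connected G.
Proof.
move=> Gc; apply/forallP=> x; apply/forallP=> y.
have cc z : connect G c z.
  by have [->|/Gc] := eqVneq z c; [apply: connect0 | apply: connect1].
apply: connect_trans (cc y).
have [->|/Gc] := eqVneq x c; first exact: connect0.
by rewrite adj_sym; apply: connect1.
Qed.

Section ApexWithPendant.
(** Here [c] is the apex, [u] is isolated once [c] is deleted, and [w] is a third vertex, from which
    that deletion separates [u]. *)
Variables (T : finType) (G : sgraph T) (c u w : T).
Hypotheses (Gc : forall x, x != c -> G c x) (Gu : forall x, G u x -> x = c).
Hypotheses (uc : u != c) (wc : w != c) (wu : w != u).

Fact pendant_not_adj : ~~ G u w.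
Proof. by apply: contraNN wc => /Gu ->. Qed.

Lemma pendant_not_complete : ~~ complete G.
Proof.
apply/negP=> /forallP/(_ u)/forallP/(_ w); rewrite eq_sym wu /=.
exact/negP/pendant_not_adj.
Qed.

Fact card_gt2 : 2 < #|T|.
Proof.
have Us : uniq [:: c; u; w].
  by rewrite /= !inE negb_or !(eq_sym c) uc wc eq_sym wu.
by have := max_card (mem [:: c; u; w]); rewrite (card_uniqP Us).
Qed.

Lemma apex_diam : diam G = 2.
Proof.
apply/eqP; rewrite eqn_leq; apply/andP; split.
  apply/bigmax_leqP=> x _; apply/bigmax_leqP=> y xy.
  have [xc|xc] := eqVneq x c.
    apply: (@leq_trans 1) => //; apply: (@dist_leq _ _ _ _ [:: y]).
    by rewrite /is_path /= inE xy eqxx xc Gc // -xc eq_sym.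
  have [yc|yc] := eqVneq y c.
    apply: (@leq_trans 1) => //; apply: (@dist_leq _ _ _ _ [:: y]).
    by rewrite /is_path /= inE xy eqxx yc adj_sym Gc.
  apply: (@dist_leq _ _ _ _ [:: c; y]).
  by rewrite /is_path /= !inE adj_sym !Gc // negb_or xc xy eqxx eq_sym yc.
apply: (@leq_trans (\max_(y | u != y) dist G u y)); last exact: leq_bigmax.
apply: leq_trans (leq_bigmax_cond _ _); last by rewrite eq_sym; exact: wu.
(* Both the default [#|T|] and every path length from [u] to [w] must be at least 2: length 0 would
   force [u = w], length 1 an edge. *)
apply: bigminn_geq => [|k /existsP[[p /= /eqP <-]]]; first exact: ltnW card_gt2.
case: p => [|x [|//]]; rewrite /is_path /=.
  by rewrite eq_sym (negPf wu).
case/and3P=> Gux /eqP xw _; case/negP: pendant_not_adj; move: Gux.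
by rewrite xw andbT.
Qed.

Lemma apex_kappa : kappa G = 1.
Proof.
apply/eqP; rewrite eqn_leq; apply/andP; split.
  (* Deleting [c] suffices: a path from [u] to [w] would have [c] as its second vertex. *)
  rewrite -(cards1 c); apply: bigminn_leq.
  have u_in : u \in ~: [set c] by rewrite !inE.
  have w_in : w \in ~: [set c] by rewrite !inE.
  apply/negP=> /forallP/(_ (Sub u u_in))/forallP/(_ (Sub w w_in)).
  case/connectP=> [[|[x x_in] p]] /=.
    by move=> _ /(congr1 val)/= wu_eq; case/eqP: wu.
  by case/andP=> /Gu /= xc; case/setCP: (x_in); rewrite xc set11.
(* The default [#|T|.-1] is positive, and deleting nothing keeps the apex, hence connectedness. *)
apply: bigminn_geq => [|S].
  by case: #|T| card_gt2 => [|[]].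
apply: contraR; rewrite -eqn0Ngt cards_eq0 => /eqP ->.
have c_in : c \in ~: set0 by rewrite !inE.
apply: (apex_connected _ _ (Sub c c_in)) => x xc; apply: Gc.
by apply: contraNneq xc => xc; apply/eqP/val_inj.
Qed.

End ApexWithPendant.

Section ConeOnOrdinals.
Variables (n : nat) (g : rel nat).

(** The apex is 0, and [g] may list each edge in one direction only. Labels live in [nat] so that
    [lia] decides adjacency. *)
Definition cone_adj : rel nat :=
  fun a b => (a != b) && [|| a == 0, b == 0, g a b | g b a].

Fact cone_sym : symmetric (relpre (@nat_of_ord n) cone_adj).
Proof. by move=> x y; rewrite /= /cone_adj; lia. Qed.

Fact cone_irr : irreflexive (relpre (@nat_of_ord n) cone_adj).
Proof. by move=> x; rewrite /= /cone_adj eqxx. Qed.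

Definition cone : sgraph 'I_n := SGraph cone_sym cone_irr.

(** The premise is a single boolean over [nat], so that [lia] proves it once the two non-adjacent
    neighbours are named. *)
Lemma not_free_cone (x : 'I_n) (a b : nat) :
    [&& a < n, b < n, a != b, cone_adj x a, cone_adj x b & ~~ cone_adj a b] ->
  free cone x = false.
Proof.
case/and5P=> lt_an lt_bn ab xa /andP[xb /negP Nab].
apply/negP=> /forallP/(_ (Ordinal lt_an))/forallP/(_ (Ordinal lt_bn)).
by rewrite -val_eqE /= xa xb ab /=.
Qed.

Lemma cone_phi (j : nat) :
    2 < n -> j < n -> (forall a b, g a b -> a < n.-1 /\ b < n.-1) ->
    (forall x : 'I_n, free cone x = (j < x)) ->
  [/\ ~~ complete cone, connected cone, kappa cone = 1 & phi cone = n - j + 2].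
Proof.
move=> n_gt2 lt_jn g_lt freeE.
have n_gt0 : 0 < n by lia.
have n_gt1 : 1 < n by lia.
have lt_u : n.-1 < n by lia.
(* The bound on [g] keeps the last label [n.-1] out of its edges, so it is adjacent to the apex
   only. *)
pose c := Ordinal n_gt0; pose u := Ordinal lt_u; pose w := Ordinal n_gt1.
have cc x : x != c -> cone c x.
  by rewrite -val_eqE /= /cone_adj /= => x0; rewrite eq_sym x0.
have cu x : cone u x -> x = c.
  rewrite /= /cone_adj /= => /andP[ux /or4P[||/g_lt|/g_lt]]; try lia.
  by move/eqP=> x0; apply: val_inj.
have uc : u != c by rewrite -val_eqE /=; lia.
have wc : w != c by rewrite -val_eqE.
have wu : w != u by rewrite -val_eqE /=; lia.
have kap := apex_kappa _ _ _ _ _ cc cu uc wc wu.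
split=> //; [exact: pendant_not_complete cu wc wu | exact: apex_connected cc |].
rewrite /phi kap (apex_diam _ _ _ _ _ cc cu uc wc wu) /nfree.
(* The non-free labels are 0 to [j], so [phi] is (n - (j + 1)) + 2 + 1. *)
have -> : [set x | free cone x] = ~: [set widen_ord lt_jn k | k : 'I_j.+1].
  apply/setP=> x; rewrite !inE freeE ltnNge; congr (~~ _).
  apply/idP/imsetP=> [le_xj|[k _ ->]]; last by rewrite /= -ltnS.
  by exists (Ordinal (le_xj : x < j.+1)) => //; apply: val_inj.
rewrite cardsCs setCK card_imset ?card_ord; first by lia.
by move=> a b /(congr1 val)/= ab; apply: val_inj.
Qed.

End ConeOnOrdinals.

(* The path j+2, 1, 2, ..., j, j+1, labelled so that its inner vertices, which are
   the non-free ones, come first. *)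
Definition path_rel (j : nat) : rel nat := fun a b =>
  [&& 0 < a, b == a.+1 & b <= j.+1] || (a == 1) && (b == j.+2).

(** The sides are {1, 2} and {3, ..., j}; larger labels are isolated before coning. *)
Definition bipartite_rel (j : nat) : rel nat := fun a b =>
  (0 < a <= 2) && (2 < b <= j).

(** A path end sees only the apex and one path vertex, which are adjacent; an inner vertex has two
    non-adjacent path neighbours. The apex sees 1 and the isolated [n.-1]. *)
Lemma free_cone_path (n j : nat) (x : 'I_n) :
  0 < j -> j.+3 < n -> free (cone n (path_rel j)) x = (j < x).
Proof.
move=> j_gt0 lt_jn; case: ltnP => [lt_jx|le_xj].
  apply/forallP=> y; apply/forallP=> z; apply/implyP.
  by rewrite -val_eqE /= /cone_adj /path_rel; lia.
have [x0|x_gt0] := posnP x.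
  by apply: (@not_free_cone _ _ _ 1 n.-1); rewrite /cone_adj /path_rel; lia.
have [x1|x_neq1] := eqVneq (x : nat) 1.
  by apply: (@not_free_cone _ _ _ 2 j.+2); rewrite /cone_adj /path_rel; lia.
by apply: (@not_free_cone _ _ _ x.-1 x.+1); rewrite /cone_adj /path_rel; lia.
Qed.

(** Each vertex of one side sees two non-adjacent vertices of the other; [3 < j] provides the pair
    3, 4. *)
Lemma free_cone_bipartite (n j : nat) (x : 'I_n) :
  3 < j -> j.+1 < n -> free (cone n (bipartite_rel j)) x = (j < x).
Proof.
move=> j_gt3 lt_jn; case: ltnP => [lt_jx|le_xj].
  apply/forallP=> y; apply/forallP=> z; apply/implyP.
  by rewrite -val_eqE /= /cone_adj /bipartite_rel; lia.
have [x0|x_gt0] := posnP x.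
  by apply: (@not_free_cone _ _ _ 1 n.-1); rewrite /cone_adj /bipartite_rel; lia.
have [x_le2|x_gt2] := leqP x 2.
  by apply: (@not_free_cone _ _ _ 3 4); rewrite /cone_adj /bipartite_rel; lia.
by apply: (@not_free_cone _ _ _ 1 2); rewrite /cone_adj /bipartite_rel; lia.
Qed.

Theorem theorem2p1 (n : nat) (hn : 8 <= n) (i : nat) (hi : 4 <= i <= n + 1) :
  exists G : sgraph 'I_n,
    [/\ ~~ complete G, connected G, kappa G = 1 & phi G = i].
Proof.
(* Solving [i = n - j + 2] for [j] turns the range of [i] into 1 <= j <= n - 2. *)
pose j := n.+2 - i; have -> : i = n - j + 2 by rewrite /j; lia.
have [j_gt0 lt_jn] : 0 < j /\ j.+1 < n by rewrite /j; lia.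
(* The path construction takes [j + 4] vertices with the apex and an isolated vertex, at most 7
   here; the bipartite one takes only [j + 2], which reaches j = n - 2. *)
have [le_j3|j_gt3] := leqP j 3.
  exists (cone n (path_rel j)); apply: cone_phi; try lia.
    by move=> a b; rewrite /path_rel; lia.
  by move=> x; apply: free_cone_path; lia.
exists (cone n (bipartite_rel j)); apply: cone_phi; try lia.
  by move=> a b; rewrite /bipartite_rel; lia.
by move=> x; apply: free_cone_bipartite.
Qed.
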